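(* Let $f:\mathbb{R}\to\mathbb{R}$ be a Lebesgue measurable function and let $\mathbb{P}$ be a probability measure on $\mathbb{R}$ equivalent to Lebesgue measure (i.e. with the same null sets). Define a stochastic process $(X_t)_{t\in\mathbb{R}}$ on the probability space $(\mathbb{R},\mathcal{F},\mathbb{P})$, $\mathcal{F}$ being the Lebesgue $\sigma$-algebra, by $X_t(\omega):=f(\omega+t)$. Then the following alternative holds: either $(X_t)_{t\in\mathbb{R}}$ is sample continuous, or for every non-null set $T\subset\mathbb{R}$ the restricted process $(X_t)|_T$ does not have a natural modification.
   Context: A set $T\subset\mathbb{R}$ (not necessarily measurable) is non-null if its Lebesgue outer measure is positive. $(X_t)|_T$ denotes the process $(X_t)_{t\in T}$, the restriction to the time set $T$. A modification of a real-valued process $(X_t)_{t\in T}$ on a probability space $(\Omega,\mathcal{F},\mathbb{P})$ is a map $\xi:\Omega\to\mathbb{R}^T$ such that for each $t\in T$, $\xi(\omega)(t)=X_t(\omega)$ for almost every $\omega$. A modification $\xi$ is called natural if there exists a second countable topology $\mathcal{T}$ on the set $T$ such that for almost every $\omega\in\Omega$ the function $\xi(\omega):T\to\mathbb{R}$ is $\mathcal{T}$-continuous. The process $(X_t)_{t\in\mathbb{R}}$ is sample continuous if it has a modification $\xi$ such that for almost every $\omega$ the path $\xi(\omega)$ is continuous on $\mathbb{R}$ in the usual topology. *)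

(* Defs.v *)
From HB Require Import structures.
From mathcomp Require Import all_boot all_order all_algebra.
From mathcomp Require Import all_classical all_reals all_analysis.

Set Implicit Arguments.
Unset Strict Implicit.
Unset Printing Implicit Defensive.

Import Order.TTheory GRing.Theory Num.Theory.
Import numFieldNormedType.Exports.
Local Open Scope classical_set_scope.
Local Open Scope ring_scope.

(** Defined for all subsets of [R]: infimum of the total length of the countable
    covers by intervals ]a, b]. *)
Definition lebesgue_outer_measure (R : realType) :
    {outer_measure set (ocitv_type R) -> \bar R} :=
  ((wlength idfun)^*)%mu.

(** The carrier is [R], with the Lebesgue sigma-algebra (the sets that are
    Caratheodory measurable for the outer measure) instead of the Borel one.
    This is the space on which [completed_lebesgue_measure] is a measure. *)
Definition lebesgueTypeR (R : realType) :=
  caratheodory_type (@lebesgue_outer_measure R).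

Section process.
Context d (Omega : measurableType d) (R : realType) (P : probability Omega R).

(** The time set is a type [I]; for a subset [T] of [R] it is [set_type T]. *)
Definition modification (I : Type) (X : I -> Omega -> R)
    (xi : Omega -> I -> R) : Prop :=
  forall t : I, \forall w \ae P, xi w t = X t w.

(** [Topological I] ranges over all topologies on [I] (bundled with an irrelevant
    choice structure); [I_tau] is [I] with the topology [tau] and nothing else,
    even when [I] carries a canonical topology. *)
Definition natural_modification (I : Type) (X : I -> Omega -> R)
    (xi : Omega -> I -> R) : Prop :=
  modification X xi /\
  exists tau : Topological I, let I_tau := Topological.Pack tau in
    @second_countable I_tau /\
    \forall w \ae P, continuous (xi w : I_tau -> R).

Definition sample_continuous (X : R -> Omega -> R) : Prop :=
  exists xi : Omega -> R -> R,
    modification X xi /\ \forall w \ae P, continuous (xi w).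

End process.

Definition restrict_time (Omega : Type) (R : realType) (T : set R)
    (X : R -> Omega -> R) : T -> Omega -> R :=
  fun t => X (set_val t).

Definition shift_process (R : realType) (f : R -> R) :
    R -> lebesgueTypeR R -> R :=
  fun t w => f ((w : R) + t).

(* Main.v *)
(** Let [U_n] be a countable base of the topology on [T] and fix [e > 0]. For
    almost every [w], continuity of [xi w] gives, for every [t] in [T], some
    [n] with [t] in [U_n] such that [xi w] varies by at most [e] on [U_n]. Pick
    a sequence in [U_n] that is dense in [U_n] for the usual topology of the
    line, and let [W_n] be the set of those [w] for which [s |-> f (w + s)]
    varies by at most [e] along it; [W_n] is Lebesgue measurable, and [T] times
    a conull set is covered by the products [closure U_n * W_n].
    After removing null sets from both factors, each of these pairs [(t, w)]
    consists of density points of [closure U_n] and [W_n]. As [T] is non-null,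
    every real [x] is [t + w] for such a pair, and two approximate continuity
    points [a], [b] of [f] close to [x] can be written, up to an arbitrarily
    small error, as [v + s], [v + s'] with [v] in [W_n] and [s], [s'] in the
    sequence. So [f] varies by at most [e] on its approximate continuity points
    near [x], and therefore coincides on this conull set with a continuous
    function. *)
Require Import Defs.
From HB Require Import structures.
From mathcomp Require Import all_boot all_order all_algebra.
From mathcomp Require Import all_classical all_reals all_analysis.
From mathcomp Require Import measurable_realfun.
From mathcomp Require Import ring lra.

Set Implicit Arguments.
Unset Strict Implicit.
Unset Printing Implicit Defensive.

Import Order.TTheory GRing.Theory Num.Theory.
Import numFieldNormedType.Exports.
Local Open Scope classical_set_scope.
Local Open Scope ring_scope.

(** * Outer measure: null sets, isometries of the line, density points *)

Section lebesgue_outer_measure_theory.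
Context {R : realType}.
Local Notation mu := (@lebesgue_outer_measure R).
Implicit Types (A B C N E : set R) (t x : R).

Lemma outer_measure_ball x (r : R) : 0 <= r -> mu (ball x r) = (r *+ 2)%:E.
Proof. exact: lebesgue_measure_ball. Qed.

Lemma outer_measureS A B : A `<=` B -> (mu A <= mu B)%E.
Proof. exact: le_outer_measure. Qed.

Lemma outer_measure0S A B : A `<=` B -> mu B = 0%E -> mu A = 0%E.
Proof.
move=> AB B0; apply/eqP; rewrite eq_le outer_measure_ge0 andbT -B0.
exact: outer_measureS.
Qed.

Lemma outer_measure0U A B : mu A = 0%E -> mu B = 0%E -> mu (A `|` B) = 0%E.
Proof.
move=> A0 B0; apply/eqP; rewrite eq_le outer_measure_ge0 andbT.
by apply: (le_trans (outer_measureU2 _ _ _)); rewrite A0 B0 adde0.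
Qed.

Lemma outer_measure0_bigcup (I : countType) (F : I -> set R) :
  (forall i, mu (F i) = 0%E) -> mu (\bigcup_i F i) = 0%E.
Proof.
move=> F0; pose G n := if unpickle n is Some i then F i else set0.
apply: (@outer_measure0S _ (\bigcup_n G n)).
  by move=> x [i _ Fix]; exists (pickle i) => //; rewrite /G pickleK.
apply/eqP; rewrite eq_le outer_measure_ge0 andbT.
apply: (le_trans (outer_measure_sigma_subadditive _ _)).
rewrite eseries0// => n _ _; rewrite /G.
by case: (unpickle n) => [i|]; rewrite ?F0 ?outer_measure0.
Qed.

(** Open supersets reduce this to an open [U]; there the pushforward of Lebesgue measure under
    [w |-> t - w] is Lebesgue measure, as both agree on intervals. *)
Lemma outer_measure_reflect t A : (mu [set w | A (t - w)%R] <= mu A)%E.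
Proof.
apply/lee_addgt0Pr => e e0.
have [U [oU AU Ue]] := outer_measure_open_le A e0.
apply: le_trans Ue.
apply: (@le_trans _ _ (mu [set w | U (t - w)%R])).
  by apply: outer_measureS => w; exact: AU.
pose r : measurableTypeR R -> measurableTypeR R := (fun w => t - w)%R.
have mr : measurable_fun setT r by exact: measurable_funB.
have mU : measurable (U : set (measurableTypeR R)) by exact: open_measurable.
have : pushforward lebesgue_measure r U =
    lebesgue_measure (U : set (measurableTypeR R)).
  apply/esym/lebesgue_measure_unique => //= _ [[a b]] _ <-.
  rewrite /pushforward.
  have -> : (r @^-1` `]a, b]) = `[t - b, t - a[%classic.
    apply/seteqP; split=> w /=; rewrite !in_itv /= /r => /andP[? ?];
      apply/andP; split; lra.
  rewrite !lebesgue_measure_itv/= !lte_fin.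
  have -> : (t - b < t - a)%R = (a < b)%R by rewrite ltrD2l ltrN2.
  case: ifP => // _; rewrite -!EFinB; congr EFin; ring.
by rewrite /pushforward => <-.
Qed.

Lemma outer_measure_translate t A : (mu [set w | A (w + t)%R] <= mu A)%E.
Proof.
(* A translation is the composition of two reflections. *)
have -> : [set w | A (w + t)] = [set w | [set v | A (t - v)] (0 - w)].
  by apply/seteqP; split => w /=; rewrite sub0r opprK addrC.
exact: le_trans (outer_measure_reflect _ _) (outer_measure_reflect _ _).
Qed.

Lemma lebesgue_measurable_translate t A :
  measurable (A : set (lebesgueTypeR R)) ->
  measurable ([set w | A (w + t)%R] : set (lebesgueTypeR R)).
Proof.
move=> mA; apply: le_caratheodory_measurable => X.
(* The Caratheodory condition of [A] is applied to a translate of the test set. *)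
pose Y := [set w | X (w - t)].
have YX : (mu Y <= mu X)%E by exact: outer_measure_translate.
apply: le_trans YX; rewrite (mA Y); apply: leeD.
- apply: le_trans (outer_measure_translate t _).
  by apply: outer_measureS => w [Xw Aw]; split=> //=; rewrite /Y/= addrK.
- apply: le_trans (outer_measure_translate t _).
  by apply: outer_measureS => w [Xw Aw]; split=> //=; rewrite /Y/= addrK.
Qed.

(** Used with [A], [B], [C] the parts of balls of radius [r] missed by sets of high density,
    possibly translated or reflected. The radius [r / 2] of the smaller ball leaves room for a
    displacement of up to [r / 2]. *)
Lemma ball_not_covered x (r : R) A B C N : 0 < r ->
  (mu A <= (r / 4)%:E)%E -> (mu B <= (r / 4)%:E)%E -> (mu C <= (r / 4)%:E)%E ->
  mu N = 0%E -> exists2 w, ball x (r / 2) w & [/\ ~ A w, ~ B w, ~ C w & ~ N w].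
Proof.
move=> r0 Ar Br Cr N0.
have : ~ ball x (r / 2) `<=` A `|` B `|` C `|` N.
  move=> /outer_measureS; apply/negP; rewrite -ltNge.
  have -> : mu (ball x (r / 2)) = r%:E.
    by rewrite outer_measure_ball ?divr_ge0 ?ltW//; congr EFin; lra.
  apply: (@le_lt_trans _ _ ((r / 4)%:E + (r / 4)%:E + (r / 4)%:E + 0)%E).
    do 2 (apply: (le_trans (outer_measureU2 _ _ _)); apply: leeD;
      rewrite ?N0//).
    by apply: (le_trans (outer_measureU2 _ _ _)); exact: leeD.
  by rewrite adde0 -!EFinD lte_fin; lra.
move=> /existsNP[w /not_implyP[xw nw]]; exists w => //.
by split=> h; apply: nw; rewrite /setU/=; tauto.
Qed.

(** Density at least 7/8 at all small scales suffices: a ball of radius [r / 2]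
    is not covered by three sets of outer measure at most [r / 4] and a null
    set. *)
Definition density_point E x := exists2 r0 : R, 0 < r0 &
  forall r, 0 < r < r0 -> (mu (ball x r `\` E) <= (r / 4)%:E)%E.

Lemma density_pointS A B x : A `<=` B -> density_point A x -> density_point B x.
Proof.
move=> AB [r0 r00 Ar]; exists r0 => // r /Ar; apply: le_trans.
by apply: outer_measureS; exact: setDS.
Qed.

(** [A] is the union of a Borel set and a null set, and the Lebesgue density theorem applies to the
    Borel part. *)
Lemma ae_density_point A : measurable (A : set (lebesgueTypeR R)) ->
  mu [set x | A x /\ ~ density_point A x] = 0%E.
Proof.
rewrite -completed_caratheodory_measurable g_sigma_completed_algebra_genE.
case=> B /= mB [N /negligible_outer_measure N0 <-{A}].
suff B0 : mu [set x | B x /\ ~ density_point B x] = 0%E.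
  apply: outer_measure0S (outer_measure0U B0 N0) => x [[Bx|Nx] nd];
    [left|by right].
  by split=> // d; apply: nd; apply: density_pointS d; exact: subsetUl.
have /negligible_outer_measure := lebesgue_density mB.
apply: outer_measure0S => x [Bx nd] /= cvx; apply: nd.
have {cvx} : (lebesgue_measure (B `&` ball x r) *
    (lebesgue_measure (ball x r))^-1 @[r --> 0^'+] --> (1%:E : \bar R))%E.
  by move: cvx; rewrite indicE mem_set.
(* The ball has measure [2 r], so density above 7/8 leaves less than [r / 4] outside [B]. *)
have nb : nbhs (1%:E : \bar R) [set y | (7 / 8)%:E < y]%E.
  apply: open_nbhs_nbhs; split; first exact: open_ereal_gt_ereal.
  by rewrite /= lte_fin; lra.
move=> /(_ _ nb)[r0 /= r00 Hr]; exists r0 => // r /andP[r_gt0 rr0].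
have {Hr} : ((7 / 8)%:E < lebesgue_measure (B `&` ball x r) *
    (lebesgue_measure (ball x r))^-1)%E.
  by apply: Hr => //=; rewrite sub0r normrN gtr0_norm.
have rr : lebesgue_measure (ball x r) = (r *+ 2)%:E.
  by rewrite lebesgue_measure_ball ?ltW.
rewrite rr inver mulrn_eq0/= gt_eqF//.
have mx : measurable (ball x r : set (measurableTypeR R)).
  by exact: measurable_ball.
have -> : mu (ball x r `\` B) = lebesgue_measure (ball x r `\` B) by [].
rewrite measureD// -?/lebesgue_measure; last by rewrite [ltLHS]rr ltry.
rewrite [X in (X - _)%E]rr [X in (_ - lebesgue_measure X)%E]setIC.
have : (lebesgue_measure (B `&` ball x r) <= (r *+ 2)%:E)%E.
  by rewrite -rr; apply: le_outer_measure; exact: subIsetr.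
have : (0 <= lebesgue_measure (B `&` ball x r))%E by exact: outer_measure_ge0.
case: (lebesgue_measure (B `&` ball x r)) => // s _ _.
rewrite -EFinM -EFinB lte_fin lee_fin ltr_pdivlMr; last by rewrite mulrn_wgt0.
by rewrite mulr2n; lra.
Qed.

End lebesgue_outer_measure_theory.

(** * Approximate continuity and sets of small increments *)

Section approximate_continuity.
Context {R : realType}.
Local Notation mu := (@lebesgue_outer_measure R).
Implicit Types (f : R -> R) (D : set R) (a t w x e : R).

Lemma ball_absE x e a : ball x e a = (`|x - a| < e) :> Prop.
Proof. by []. Qed.

Lemma rat_approx x e : 0 < e -> exists n (q : rat),
  `|x - ratr q| < n.+1%:R^-1 /\ n.+1%:R^-1 *+ 2 <= e.
Proof.
move=> e0; have e20 : 0 < e / 2 by rewrite divr_gt0.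
have [n _ nlt] := near_infty_natSinv_lt (PosNum e20).
have := nlt n (leqnn n); have : 0 < n.+1%:R^-1 :> R by rewrite invr_gt0.
move En : n.+1%:R^-1 => u u0 /= ue.
have [q] : exists q : rat, ratr q \in `]x - u, x + u[.
  by apply: rat_in_itvoo; lra.
rewrite in_itv/= => /andP[q1 q2]; exists n, q.
rewrite En mulr2n; split; last by lra.
by rewrite ltr_norml; apply/andP; split; lra.
Qed.

(** The usual density 1 is relaxed to the 7/8 of [density_point]. *)
Definition approx_continuous f a := forall e, 0 < e ->
  density_point [set y | `|f y - f a| < e] a.

(** Almost every point is a density point of each set [A k] containing it, since there are countably
    many; at a given scale one such set lies where [f] is close to [f a]. *)
Lemma ae_approx_continuous f : measurable_fun [set: lebesgueTypeR R] f ->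
  mu [set a | ~ approx_continuous f a] = 0%E.
Proof.
move=> mf.
pose A (k : nat * rat) := [set y | `|f y - ratr k.2| < k.1.+1%:R^-1].
have mA k : measurable (A k : set (lebesgueTypeR R)).
  have -> : A k = [set: lebesgueTypeR R] `&`
      f @^-1` `]ratr k.2 - k.1.+1%:R^-1, ratr k.2 + k.1.+1%:R^-1[.
    by rewrite setTI; apply/seteqP; split => y; rewrite /A/= in_itv/= ltr_distl.
  exact: mf.
apply: outer_measure0S
  (outer_measure0_bigcup (fun k => ae_density_point (mA k))).
move=> a; apply: contra_notP => na e e0.
have [n [q [nq ne]]] := rat_approx (f a) e0.
have Aa : A (n, q) a by [].
have : density_point (A (n, q)) a.
  by apply: contrapT => nd; apply: na; exists (n, q).
apply: density_pointS => y; rewrite /A/= => yq.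
rewrite (le_lt_trans (ler_distD (ratr q) _ _))//.
rewrite (distrC _ (f a)); apply: lt_le_trans ne.
by rewrite mulr2n ltrD.
Qed.

Definition small_increments f D e : set R :=
  [set w | forall s t, D s -> D t -> `|f (w + s) - f (w + t)| <= e].

(** The points [a - w], [b - w] are replaced by nearby points [s], [t] of [D].
    Near [w], the set of small increments and the translates by [- s] and [- t]
    of the sets where [f] is close to [f a] and to [f b] all have density at
    least 7/8, so they share a point. *)
Lemma approx_continuous_dist_le f D e a b w :
  approx_continuous f a -> approx_continuous f b ->
  density_point (small_increments f D e) w ->
  closure D (a - w) -> closure D (b - w) -> `|f a - f b| <= e.
Proof.
move=> ca cb [rw rw0 dw] Da Db; apply/ler_addgt0Pl => e2 e20.
have e40 : 0 < e2 / 2 by rewrite divr_gt0.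
have [ra ra0 da] := ca _ e40; have [rb rb0 db] := cb _ e40.
pose r := Num.min (Num.min ra rb) rw / 2.
have r0 : 0 < r by rewrite divr_gt0// !lt_min ra0 rb0.
have [rra rrb rrw] : [/\ r < ra, r < rb & r < rw].
  have : r < Num.min (Num.min ra rb) rw by rewrite /r in r0 *; lra.
  by rewrite !lt_min => /andP[/andP[]].
have r20 : 0 < r / 2 by rewrite divr_gt0.
(* As [s] is within [r / 2] of [a - w], translation by [s] maps [ball w (r / 2)] into [ball a r]. *)
have [s [Ds]] := Da _ (nbhsx_ballx _ _ r20).
have [t [Dt]] := Db _ (nbhsx_ballx _ _ r20).
rewrite !ball_absE !ltr_norml => /andP[t1 t2] /andP[s1 s2].
have rr x : 0 < x -> r < x -> 0 < r < x by move=> _ ->; rewrite r0.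
have Na := le_trans (outer_measure_translate s _) (da _ (rr _ ra0 rra)).
have Nb := le_trans (outer_measure_translate t _) (db _ (rr _ rb0 rrb)).
have Nw := dw _ (rr _ rw0 rrw).
have [v] := ball_not_covered w r0 Na Nb Nw (outer_measure0 _).
rewrite ball_absE ltr_norml => /andP[v1 v2] [va vb vw _].
have {}va : `|f (v + s) - f a| < e2 / 2.
  apply: contrapT => h; apply: va; split=> //=.
  by rewrite ball_absE ltr_norml; apply/andP; split; lra.
have {}vb : `|f (v + t) - f b| < e2 / 2.
  apply: contrapT => h; apply: vb; split=> //=.
  by rewrite ball_absE ltr_norml; apply/andP; split; lra.
have {}vw : small_increments f D e v.
  apply: contrapT => h; apply: vw; split=> //=.
  by rewrite ball_absE ltr_norml; apply/andP; split; lra.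
have := vw _ _ Ds Dt.
move: va vb; rewrite !ltr_norml !ler_norml => /andP[? ?] /andP[? ?] /andP[? ?].
by apply/andP; split; lra.
Qed.

(** For [a], [b] near [x], the reflections [v |-> a - v] and [v |-> b - v] map points near [w] to
    points near [x - w], where [closure D] is dense in measure. Hence some [v] near [w] has [a - v]
    and [b - v] in [closure D] and is a density point of the small increments. *)
Lemma approx_continuous_locally_close f D e x w :
  mu [set v | small_increments f D e v /\
              ~ density_point (small_increments f D e) v] = 0%E ->
  density_point (small_increments f D e) w ->
  density_point (closure D) (x - w) ->
  exists2 d, 0 < d & forall a b,
    approx_continuous f a -> approx_continuous f b ->
    ball x d a -> ball x d b -> `|f a - f b| <= e.
Proof.
move=> N0 [rw rw0 dw] [rt rt0 dt].
pose r := Num.min rw rt / 2.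
have r0 : 0 < r by rewrite divr_gt0// !lt_min rw0.
have [rrw rrt] : r < rw /\ r < rt.
  have : r < Num.min rw rt by rewrite /r in r0 *; lra.
  by rewrite !lt_min => /andP[].
exists (r / 2) => [|a b ca cb]; first by rewrite divr_gt0.
rewrite !ball_absE !ltr_norml => /andP[a1 a2] /andP[b1 b2].
have rr y : r < y -> 0 < r < y by rewrite r0.
have Na := le_trans (outer_measure_reflect a _) (dt _ (rr _ rrt)).
have Nb := le_trans (outer_measure_reflect b _) (dt _ (rr _ rrt)).
have [v] := ball_not_covered w r0 Na Nb (dw _ (rr _ rrw)) N0.
rewrite ball_absE ltr_norml => /andP[v1 v2] [va vb vw vd].
have {}vw : small_increments f D e v.
  apply: contrapT => h; apply: vw; split=> //=.
  by rewrite ball_absE ltr_norml; apply/andP; split; lra.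
apply: (@approx_continuous_dist_le f D e a b v) => //.
- by apply: contrapT => h; apply: vd.
- apply: contrapT => h; apply: va; split=> //=.
  by rewrite ball_absE ltr_norml; apply/andP; split; lra.
- apply: contrapT => h; apply: vb; split=> //=.
  by rewrite ball_absE ltr_norml; apply/andP; split; lra.
Qed.

End approximate_continuity.

(** * Countable covers from a natural modification, and continuous extension *)

Section natural_modifications.
Context {R : realType}.
Local Notation mu := (@lebesgue_outer_measure R).
Implicit Types (f : R -> R) (a t w x e : R).

Lemma exists_dense_sequence (I : Type) (v : I -> R) (S : set I) : S !=set0 ->
  exists u : nat -> I, range u `<=` S /\ v @` S `<=` closure (range (v \o u)).
Proof.
move=> [s0 Ss0].
pose near (k : nat * rat) s := S s /\ `|v s - ratr k.2| < k.1.+1%:R^-1.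
have /choice[p pP] : forall k, exists s,
    S s /\ ((exists s', near k s') -> near k s).
  move=> k; have [[s ks]|nk] := pselect (exists s, near k s).
    by exists s; split; [case: ks|].
  by exists s0; split=> // /nk.
pose u n := if unpickle n is Some k then p k else s0.
exists u; split=> [_ [n _ <-]|_ [x Sx <-] B /nbhs_ballP[e /= e0 eB]].
  by rewrite /u; case: (unpickle n) => // k; case: (pP k).
have [n [q [xq ne]]] := rat_approx (v x) e0.
exists (v (p (n, q))); split.
  by exists (pickle (n, q)); rewrite /u/= ?pickleK.
have [_ /(_ (ex_intro _ x (conj Sx xq)))[_ pq]] := pP (n, q).
apply: eB; rewrite ball_absE (le_lt_trans (ler_distD (ratr q) _ _))//.
by rewrite (distrC _ (v (p _))); apply: lt_le_trans ne; rewrite mulr2n ltrD.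
Qed.

(** Along a sequence the condition is a countable intersection of measurable ones. *)
Lemma measurable_small_increments f (d : nat -> R) e :
  measurable_fun [set: lebesgueTypeR R] f ->
  measurable (small_increments f (range d) e : set (lebesgueTypeR R)).
Proof.
move=> mf.
have mft t : measurable_fun [set: lebesgueTypeR R]
    (fun w : lebesgueTypeR R => f ((w : R) + t)).
  move=> _ B mB; rewrite setTI.
  apply: (@lebesgue_measurable_translate _ t (f @^-1` B)).
  by rewrite -[X in measurable X]setTI; exact: mf.
have -> : small_increments f (range d) e = \bigcap_i \bigcap_j
    ([set: lebesgueTypeR R] `&`
     (fun w : lebesgueTypeR R => f ((w : R) + d i) - f ((w : R) + d j))
       @^-1` `[- e, e]).
  apply/seteqP; split => w.
    move=> H i _ j _; split => //=; rewrite in_itv/= -ler_norml.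
    by apply: H; [exists i|exists j].
  move=> H _ _ [i _ <-] [j _ <-]; have [_ /=] := H i I j I.
  by rewrite in_itv/= -ler_norml.
apply: bigcapT_measurable => i; apply: bigcapT_measurable => j.
have mB := measurable_funB (mft (d i)) (mft (d j)).
by apply: mB => //; exact: measurable_itv.
Qed.

Lemma cover_locally_close f (d : nat -> nat -> R) (T N : set R) e :
  measurable_fun [set: lebesgueTypeR R] f -> (0 < mu T)%E -> mu N = 0%E ->
  (forall t w, T t -> ~ N w -> exists n,
     closure (range (d n)) t /\ small_increments f (range (d n)) e w) ->
  forall x, exists2 r, 0 < r & forall a b,
    approx_continuous f a -> approx_continuous f b ->
    ball x r a -> ball x r b -> `|f a - f b| <= e.
Proof.
move=> mf T0 N0 cov x.
pose W n := small_increments f (range (d n)) e.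
pose C n := closure (range (d n)).
have W0 n : mu [set w | W n w /\ ~ density_point (W n) w] = 0%E.
  exact/ae_density_point/measurable_small_increments.
have C0 n : mu [set t | C n t /\ ~ density_point (C n) t] = 0%E.
  apply: ae_density_point; apply: sub_caratheodory.
  exact: closed_measurable (@closed_closure _ _).
pose N1 := N `|` \bigcup_n [set w | W n w /\ ~ density_point (W n) w].
pose N2 := \bigcup_n [set t | C n t /\ ~ density_point (C n) t].
have N10 : mu [set t | N1 (x - t)] = 0%E.
  apply/eqP; rewrite eq_le outer_measure_ge0 andbT.
  rewrite (le_trans (outer_measure_reflect _ _))// outer_measure0U//.
  exact: outer_measure0_bigcup.
(* Non-nullity of [T] provides a [t] for which both [t] and [w = x - t] avoid the exceptional
   sets. *)
have : ~ T `<=` [set t | N1 (x - t)] `|` N2.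
  move=> /outer_measure0S TN; move: T0; rewrite TN ?ltxx//.
  by apply: outer_measure0U => //; exact: outer_measure0_bigcup.
move=> /existsNP[t /not_implyP[Tt /not_orP[/not_orP[Nt N1t] N2t]]].
have [n [Ct Wt]] := cov _ _ Tt Nt.
apply: (approx_continuous_locally_close (W0 n) (w := x - t)).
  by apply: contrapT => h; apply: N1t; exists n.
by rewrite opprB addrC subrK; apply: contrapT => h; apply: N2t; exists n.
Qed.

(** The value at [x] is the limit of [f] along [L], which exists because the oscillation bound makes
    the image filter Cauchy. *)
Lemma continuous_extension f (L : set R) :
  (forall x, closure L x) ->
  (forall e, 0 < e -> forall x, exists2 r, 0 < r & forall a b,
    L a -> L b -> ball x r a -> ball x r b -> `|f a - f b| <= e) ->
  exists g : R -> R, continuous g /\ forall a, L a -> g a = f a.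
Proof.
move=> Ld Lf.
pose F x := f @ within L (nbhs x).
have LP x : ProperFilter (within L (nbhs x)).
  apply: Build_ProperFilter_ex => B xB.
  by have [y [Ly By]] := Ld x _ xB; exists y; exact: By.
have FP x : ProperFilter (F x) by exact: fmap_proper_filter.
have cvF x : cvg (F x).
  apply/cauchy_cvgP/cauchyP => e /= e0.
  have [|r r0 Hr] := Lf (e / 2) _ x; first by rewrite divr_gt0.
  have [a [La xa]] := Ld x _ (nbhsx_ballx x _ r0).
  exists (f a); apply/nbhs_ballP; exists r => //= b xb Lb.
  by rewrite /= ball_absE (le_lt_trans (Hr _ _ La Lb xa xb))//; lra.
pose g x := lim (F x).
(* The bound survives when one value of [f] is replaced by a limit; this yields both continuity of
   [g] and agreement with [f] on [L]. *)
have gP x r e : (forall a b, L a -> L b -> ball x r a -> ball x r b ->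
    `|f a - f b| <= e) -> forall y a, ball x r y -> L a -> ball x r a ->
    `|f a - g y| <= e.
  move=> H y a xy La xa.
  have : closed [set z | `|f a - z| <= e].
    have -> : [set z | `|f a - z| <= e] = closed_ball_ Num.norm (f a) e by [].
    exact: closed_closed_ball_.
  move/(@closed_cvg _ _ (within L (nbhs y)) _ f); apply; last exact: cvF.
  have ob : nbhs y (ball x r).
    by apply: open_nbhs_nbhs; split => //; exact: ball_open.
  by rewrite near_withinE; apply: filterS ob => b xb Lb; exact: H.
exists g; split=> [x|a La].
  apply/cvgrPdist_le => e e0.
  have [|r r0 /gP Hr] := Lf (e / 2) _ x; first by rewrite divr_gt0.
  have [a [La xa]] := Ld x _ (nbhsx_ballx x _ r0).
  apply: filterS (nbhsx_ballx x _ r0) => y xy.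
  rewrite (le_trans (ler_distD (f a) _ _))// [leRHS](splitr e) distrC.
  by rewrite lerD// Hr//; exact: ballxx.
apply/eqP; rewrite eq_sym -subr_eq0 -normr_le0; apply/ler_addgt0Pl => e e0.
rewrite addr0.
have [r r0 /gP Hr] := Lf _ e0 a.
by apply: Hr => //; exact: ballxx.
Qed.

Lemma conull_dense (L : set R) : mu (~` L) = 0%E -> forall x, closure L x.
Proof.
move=> L0 x B /nbhs_ballP[e /= e0 eB]; apply: contrapT => nLB.
have : ball x e `<=` ~` L by move=> y /eB By Ly; apply: nLB; exists y.
move=> /outer_measure0S/(_ L0)/eqP; rewrite outer_measure_ball ?ltW//.
by rewrite eqe mulrn_eq0/= gt_eqF.
Qed.

Lemma second_countable_sequence (X : topologicalType) :
  @second_countable X -> exists U : nat -> set X,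
    forall (x : X) B, nbhs x B -> exists n, U n x /\ U n `<=` B.
Proof.
move=> [C /countable_injP[h hi] [_ bC]].
(* [U n] is the base set with code [n], and is empty if there is none. *)
pose U n := [set y | exists V, [/\ C V, h V = n & V y]].
exists U => x B /(bC x)[V [CV Vx] VB].
exists (h V); split=> [|y [W [CW WV Wy]]]; first by exists V.
by apply: VB; rewrite -(hi _ _ _ _ WV) ?inE.
Qed.

Lemma null_of_negligible (P : probability (lebesgueTypeR R) R) (N : set R) :
  @completed_lebesgue_measure R `<< P -> P.-negligible N -> mu N = 0%E.
Proof.
move=> mu_P [A [mA A0 NA]]; apply: outer_measure0S NA _.
apply: (mu_P A) => //.
by apply: negligible_null_set; exact/negligibleP.
Qed.

Lemma negligible_of_null (P : probability (lebesgueTypeR R) R) (N : set R) :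
  P `<< @completed_lebesgue_measure R -> mu N = 0%E -> P.-negligible N.
Proof.
move=> P_mu N0.
have mN : measurable (N : set (lebesgueTypeR R)).
  apply: negligible_sub_caratheodory.
  have /negligible_outer_measure[A [mA A0 NA]] := N0.
  by exists A; split=> //; exact: sub_caratheodory.
exists N; split=> //; apply: (P_mu N) => //; apply/measure0_null_setP => //.
Qed.

(** The paths are compared with [f] only at the countably many points [u n m], so a single null set
    [N] serves all [t] and all [e]. *)
Lemma natural_modification_cover f (P : probability (lebesgueTypeR R) R)
    (T : set R) (xi : lebesgueTypeR R -> T -> R) :
  @completed_lebesgue_measure R `<< P -> T !=set0 ->
  natural_modification P (restrict_time (shift_process f)) xi ->
  exists (d : nat -> nat -> R) (N : set R), mu N = 0%E /\
    forall e, 0 < e -> forall t w, T t -> ~ N w -> exists n,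
      closure (range (d n)) t /\ small_increments f (range (d n)) e w.
Proof.
move=> mu_P [t0 Tt0] [xiX [tau /= [/second_countable_sequence[U Ub] xic]]].
have /choice[u uP] : forall n, exists u : nat -> T, U n !=set0 ->
    range u `<=` U n /\ set_val @` U n `<=` closure (range (set_val \o u)).
  move=> n.
  have [/(exists_dense_sequence set_val)[u uP]|] := pselect (U n !=set0).
    by exists u.
  (* An arbitrary constant sequence when [U n] is empty. *)
  by exists (fun=> exist _ t0 (mem_set Tt0)).
exists (fun n => set_val \o u n).
pose bad (s : T) := [set w : R | xi w s <> f (w + set_val s)].
exists (~` [set w | continuous (xi w : Topological.Pack tau -> R)] `|`
  \bigcup_(k in [set: nat * nat]) bad (u k.1 k.2)); split.
  apply: outer_measure0U; first exact: null_of_negligible xic.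
  by apply: outer_measure0_bigcup => k; exact: null_of_negligible (xiX _).
move=> e e0 t w Tt /not_orP[/contrapT/= wc wb].
have xiE n m : xi w (u n m) = f (w + set_val (u n m)).
  by apply: contrapT => h; apply: wb; exists (n, m).
pose t' : T := exist _ t (mem_set Tt).
have e20 : 0 < e / 2 by rewrite divr_gt0.
have [n [Unt UB]] := Ub t' _ (wc t' _ (nbhsx_ballx _ _ e20)).
exists n; have [uU Uc] := uP n (ex_intro _ t' Unt).
split=> [|_ _ [i _ <-] [j _ <-]]; first by apply: Uc; exists t'.
have Ui : ball (xi w t') (e / 2) (xi w (u n i)).
  by apply: UB; apply: uU; exists i.
have Uj : ball (xi w t') (e / 2) (xi w (u n j)).
  by apply: UB; apply: uU; exists j.
rewrite /= -!xiE (le_trans (ler_distD (xi w t') _ _))// [leRHS](splitr e).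
by rewrite lerD// ltW// distrC.
Qed.

End natural_modifications.

Theorem theorem3 (R : realType) (f : R -> R)
    (mf : measurable_fun [set: lebesgueTypeR R] f)
    (P : probability (lebesgueTypeR R) R)
    (P_mu : P `<< @completed_lebesgue_measure R)
    (mu_P : @completed_lebesgue_measure R `<< P) :
  sample_continuous P (shift_process f) \/
  (forall T : set R, (0 < lebesgue_outer_measure R T)%E ->
     ~ exists xi : lebesgueTypeR R -> T -> R,
         natural_modification P (restrict_time (shift_process f)) xi).
Proof.
have [[T [T0 [xi xiP]]]|H] := pselect (exists T : set R,
    (0 < lebesgue_outer_measure R T)%E /\ exists xi : lebesgueTypeR R -> T -> R,
    natural_modification P (restrict_time (shift_process f)) xi); last first.
  by right=> T T0 xiP; apply: H; exists T.
left.
have T_neq0 : T !=set0.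
  by apply/set0P; apply: contraTneq T0 => ->; rewrite outer_measure0 ltxx.
have [d [N [N0 cov]]] := natural_modification_cover mu_P T_neq0 xiP.
have L0 : lebesgue_outer_measure R (~` approx_continuous f) = 0%E.
  exact: ae_approx_continuous.
have [g [gc gf]] := continuous_extension (conull_dense L0)
  (fun e e0 => cover_locally_close mf T0 N0 (cov e e0)).
(* For fixed [t] this can differ from [f (w + t)] only if [w + t] lies in the null set where
   approximate continuity fails. *)
exists (fun w t => g ((w : R) + t)); split=> [t|].
  apply: (negligible_of_null P_mu).
  apply: (@outer_measure0S _ _ [set w | ~ approx_continuous f (w + t)]).
    by move=> w; apply: contra_not => /gf.
  apply/eqP; rewrite eq_le outer_measure_ge0 andbT -L0.
  exact: outer_measure_translate.
apply: aeW => w t; apply: continuous_comp; last exact: gc.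
by apply: cvgD; [exact: cvg_cst|exact: cvg_id].
Qed.
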